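(* Let $m$ be a positive integer and $q=2^m$. Then $$f(x)=x^2+x+x^q+x^{2q^2+2q}+x^{2q^2+2}$$ is a permutation polynomial over $\mathbb{F}_{q^3}$.
   Context: $\mathbb{F}_{q^3}$ denotes the finite field with $q^3$ elements. A polynomial $f\in\mathbb{F}_{q^3}[x]$ is a permutation polynomial over $\mathbb{F}_{q^3}$ if the associated map $c\mapsto f(c)$ from $\mathbb{F}_{q^3}$ to itself is a bijection. *)

(* Defs.v *)
From HB Require Import structures.
From mathcomp Require Import all_boot all_order all_algebra all_field.
Set Implicit Arguments.
Unset Strict Implicit.
Unset Printing Implicit Defensive.
Import GRing.Theory.
Local Open Scope ring_scope.

Definition permutation_poly (F : finFieldType) (f : {poly F}) : Prop :=
  bijective (fun c : F => f.[c]).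

(* Main.v *)
Require Import Defs.
From HB Require Import structures.
From mathcomp Require Import all_boot all_order all_algebra all_field ring.
Set Implicit Arguments.
Unset Strict Implicit.
Unset Printing Implicit Defensive.
Import GRing.Theory.
Local Open Scope ring_scope.

(** Let [phi u = u ^+ q], so that [phi] has order dividing 3 and
    [f u = u^2 + u + phi u + (phi^2 u)^2 (phi u + u)^2].  The trace
    [T = u + phi u + phi^2 u] satisfies [tr (f u) = (tr u)^2], so [f u]
    determines [T]; once [T] is fixed, replacing [phi u + u] by [T + phi^2 u]
    makes [f] affine over [F_2].  Injectivity therefore amounts to the
    vanishing of every [z] of trace zero with
    [(phi z)^2 + z + T^2 z^2 + z^4 = 0].  In terms of the second and third
    elementary symmetric functions [E], [N] of the conjugates of [z], this
    equation and its conjugates imply [E (N + N^2 + E^2) = 0].  If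
    [N + N^2 + E^2 = 0], then [E + N] is a root, fixed by [phi], of the cubic
    [X^3 + E X + N] whose roots are the conjugates of [z].  If [E = 0] and [z]
    is nonzero, then [phi z = T z], [1 + T + T^2 = 0] and [z^3 = 1].  Either
    way [z] is fixed by [phi], and being of trace zero it vanishes. *)

(** As [ring] does not know that 2 = 0, each identity valid only in characteristic 2 is proved over
    the integers with an explicit correction: [k] is half the difference of the two sides. *)
Lemma eq_mod2 (R : pzRingType) (k a b : R) :
  2%:R = 0 :> R -> a = b + 2%:R * k -> a = b.
Proof. by move=> -> ->; rewrite mul0r addr0. Qed.

Lemma char2_addr_eq0 (R : comNzRingType) (a b : R) :
  2%:R = 0 :> R -> a + b = 0 -> a = b.
Proof.
move=> h2 hab; apply: (eq_mod2 (k := - b) h2).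
by transitivity (a + b - 2%:R * b + b); [ring | rewrite hab; ring].
Qed.

(* The letters [a] and [b] of the proof are the two cyclic sums of [x ^+ 2 * z];
   the first two steps are the traces of the equations multiplied by [z] and by
   [x], and the parameter [s] is eliminated through [a * b = E^3 + N^2]. *)
Lemma zero_trace_relation (R : comNzRingType) (s x y z : R) :
    2%:R = 0 :> R -> z = x + y ->
    x ^+ 2 + (z + s * z ^+ 2 + z ^+ 4) = 0 ->
    y ^+ 2 + (x + s * x ^+ 2 + x ^+ 4) = 0 ->
    z ^+ 2 + (y + s * y ^+ 2 + y ^+ 4) = 0 ->
  let E := x * y + y * z + z * x in let N := x * y * z in
  x ^+ 2 * z + y ^+ 2 * x + z ^+ 2 * y = (s + E) * N /\
  E * (N + N ^+ 2 + E ^+ 2) = 0.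
Proof.
move=> h2 hz e1 e2 e3 E N.
pose a := x ^+ 2 * z + y ^+ 2 * x + z ^+ 2 * y.
pose b := x ^+ 2 * y + y ^+ 2 * z + z ^+ 2 * x.
have ha : a + (s + E) * N = 0.
  transitivity (z * (x ^+ 2 + (z + s * z ^+ 2 + z ^+ 4))
    + x * (y ^+ 2 + (x + s * x ^+ 2 + x ^+ 4))
    + y * (z ^+ 2 + (y + s * y ^+ 2 + y ^+ 4))); last first.
    by rewrite e1 e2 e3; ring.
  apply: (eq_mod2 (k := - (x ^+ 5 + 2 * x ^+ 4 * y + 3 * x ^+ 3 * y ^+ 2
    + 3 * x ^+ 2 * y ^+ 3 + 2 * x * y ^+ 4 + y ^+ 5
    + s * (x ^+ 3 + x ^+ 2 * y + x * y ^+ 2 + y ^+ 3)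
    + x ^+ 2 + x * y + y ^+ 2)) h2).
  by rewrite /a /E /N hz; ring.
have hb : N + E + N * E + (s + E) * b = 0.
  transitivity (x * (x ^+ 2 + (z + s * z ^+ 2 + z ^+ 4))
    + y * (y ^+ 2 + (x + s * x ^+ 2 + x ^+ 4))
    + z * (z ^+ 2 + (y + s * y ^+ 2 + y ^+ 4))); last first.
    by rewrite e1 e2 e3; ring.
  apply: (eq_mod2 (k := x ^+ 4 * y + 5 * x ^+ 3 * y ^+ 2
    + 5 * x ^+ 2 * y ^+ 3 + 2 * x * y ^+ 4
    - x ^+ 3 - x ^+ 2 * y - x * y ^+ 2 - y ^+ 3) h2).
  by rewrite /b /E /N hz; ring.
have hab : a * b = E ^+ 3 + N ^+ 2.
  apply: (eq_mod2 (k := - 2 * x * y * (x ^+ 4 + 5 * x ^+ 3 * y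
    + 8 * x ^+ 2 * y ^+ 2 + 5 * x * y ^+ 3 + y ^+ 4)) h2).
  by rewrite /a /b /E /N hz; ring.
have haE := char2_addr_eq0 h2 ha; split=> //.
rewrite haE in hab.
transitivity (N * (N + E + N * E + (s + E) * b)
  + (E ^+ 3 + N ^+ 2 - (s + E) * N * b)); last by rewrite hb hab; ring.
by apply: (eq_mod2 (k := - N ^+ 2) h2); move: (E) (N) (b) => u v w; ring.
Qed.

Lemma trivial_kernel (F : fieldType) (phi : {rmorphism F -> F}) (T z : F) :
    2%:R = 0 :> F -> phi T = T -> phi (phi (phi z)) = z ->
    z + phi z + phi (phi z) = 0 ->
    phi z ^+ 2 + (z + T ^+ 2 * z ^+ 2 + z ^+ 4) = 0 ->
  z = 0.
Proof.
move=> h2 phiT phiz tr0 ker_z.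
set x := phi z in tr0 ker_z phiz; set y := phi x in tr0 phiz.
have hz : z = x + y by apply: char2_addr_eq0 => //; rewrite addrA.
have fixed_eq0 t : phi t = t -> z = t -> z = 0.
  move=> phit zt; have xt : x = t by rewrite /x zt.
  have yt : y = t by rewrite /y xt.
  by apply: (eq_mod2 (k := t) h2); rewrite hz xt yt; ring.
have ker_x : y ^+ 2 + (x + T ^+ 2 * x ^+ 2 + x ^+ 4) = 0.
  have := congr1 phi ker_z.
  by rewrite !(rmorphD, rmorphXn, rmorphM) /= phiT rmorph0.
have ker_y : z ^+ 2 + (y + T ^+ 2 * y ^+ 2 + y ^+ 4) = 0.
  have := congr1 phi ker_x.
  by rewrite !(rmorphD, rmorphXn, rmorphM) /= phiT rmorph0 phiz.
have := zero_trace_relation h2 hz ker_z ker_x ker_y.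
set E := (x * y + y * z + z * x); set N := x * y * z => /= -[hsN /eqP].
rewrite mulf_eq0 => /orP[/eqP E0|/eqP hEN]; last first.
  pose t := E + N.
  have phit : phi t = t.
    by rewrite /t /E /N !rmorphD !rmorphM /= phiz -/x -/y; ring.
  (* The trace being zero, this product is t^3 + E t + N modulo 2; at t = E + N it factors through N
     + N^2 + E^2. *)
  have : (t + x) * (t + y) * (t + z) = 0.
    transitivity ((N + N ^+ 2 + E ^+ 2) * (E + N + 1)); last first.
      by rewrite hEN mul0r.
    transitivity (t ^+ 3 + E * t + N).
      apply: (eq_mod2 (k := x * t ^+ 2 + y * t ^+ 2) h2).
      by move: (t) => u; rewrite /E /N hz; ring.
    apply: (eq_mod2 (k := E ^+ 2 * N + E * N ^+ 2 - N ^+ 2) h2).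
    by rewrite /t; move: (E) (N) => u v; ring.
  (* Whichever conjugate equals the fixed [t], applying [phi] carries it to [z] and leaves [t]
     unchanged. *)
  move/eqP; rewrite !mulf_eq0 -orbA => /or3P[] /eqP /(char2_addr_eq0 h2) ht.
  - by apply: (fixed_eq0 t) => //; rewrite -phiz /y -ht !phit.
  - by apply: (fixed_eq0 t) => //; rewrite -phiz -ht phit.
  - exact: (fixed_eq0 t).
have [//|z_neq0] := eqVneq z 0.
(* When E = 0 and z = x + y, the cyclic sum in [hsN] reduces to x^2 z and N to z^3; then [z]
   cancels. *)
have hx2 : x ^+ 2 = T ^+ 2 * z ^+ 2.
  apply: (mulIf z_neq0).
  transitivity ((T ^+ 2 + E) * N - y * E).
    by rewrite -hsN /E hz; ring.
  rewrite E0; apply: (eq_mod2 (k := - T ^+ 2 * z ^+ 3) h2).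
  transitivity (T ^+ 2 * (z * E - z ^+ 3)); last by rewrite E0; ring.
  by rewrite /E /N hz; ring.
have hx : x = T * z.
  apply: char2_addr_eq0 => //; apply/eqP; rewrite -sqrf_eq0; apply/eqP.
  apply: (eq_mod2 (k := T ^+ 2 * z ^+ 2 + T * z * x) h2).
  by rewrite sqrrD hx2; ring.
have hT : 1 + T + T ^+ 2 = 0.
  apply: (mulIf (expf_neq0 2 z_neq0)); rewrite mul0r -E0.
  transitivity (z ^+ 2 + T * z * z + (T * z) ^+ 2); first by ring.
  rewrite -hx; apply: (eq_mod2 (k := x ^+ 2) h2).
  by rewrite /E hz; ring.
have hz3 : z ^+ 3 + 1 = 0.
  apply: (mulIf z_neq0); rewrite mul0r -ker_z hx2.
  by apply: (eq_mod2 (k := - T ^+ 2 * z ^+ 2) h2); ring.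
(* By [hT] the cube roots of unity are 1, T and T^2, all fixed by [phi]. *)
have : (z + 1) * (z + T) * (z + T ^+ 2) = 0.
  transitivity (z ^+ 3 + 1 + (1 + T + T ^+ 2) * (z ^+ 2 + T * z + T - 1)).
    by ring.
  by rewrite hz3 hT mul0r addr0.
move/eqP; rewrite !mulf_eq0 -orbA => /or3P[] /eqP /(char2_addr_eq0 h2).
- by apply: fixed_eq0; rewrite rmorph1.
- exact: fixed_eq0.
- by apply: fixed_eq0; rewrite rmorphXn /= phiT.
Qed.

Lemma cubic_frobenius_injective (F : fieldType) (phi : {rmorphism F -> F}) :
    2%:R = 0 :> F -> (forall u, phi (phi (phi u)) = u) ->
  injective (fun u => u ^+ 2 + u + phi u + phi (phi u) ^+ 2 * phi u ^+ 2
                      + phi (phi u) ^+ 2 * u ^+ 2).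
Proof.
move=> h2 phi3; set f := fun u => _; pose tr u := u + phi u + phi (phi u).
have phi_tr u : phi (tr u) = tr u by rewrite /tr !rmorphD /= phi3; ring.
have tr_f u : tr (f u) = tr u ^+ 2.
  pose v := phi u; pose w := phi v.
  apply: (eq_mod2 (k := u + v + w + u ^+ 2 * v ^+ 2 + v ^+ 2 * w ^+ 2
    + w ^+ 2 * u ^+ 2 - u * v - v * w - w * u) h2).
  by rewrite /tr /f !(rmorphD, rmorphXn, rmorphM) /= !phi3 -/v -/w; ring.
have fE u : f u = u ^+ 2 + (phi (phi u) + tr u ^+ 2 * phi (phi u) ^+ 2
    + phi (phi u) ^+ 4) + tr u.
  pose v := phi u; pose w := phi v.
  apply: (eq_mod2 (k := - (w + w ^+ 4 + w ^+ 2 * (u * v + v * w + w * u))) h2).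
  by rewrite /f /tr -/v -/w; ring.
have sqr_inj : injective (fun u : F => u ^+ 2).
  move=> a b /eqP; rewrite eqf_sqr => /orP[/eqP//|/eqP->].
  by apply: (eq_mod2 (k := - b) h2); ring.
move=> a b fab.
have trab : tr a = tr b by apply: sqr_inj; rewrite -!tr_f fab.
apply: char2_addr_eq0 => //.
(* In [fE] the square is that of u = phi (phi^2 u), so the kernel equation is one for z = phi^2 (a +
   b), with phi z = a + b. *)
suff z0 : phi (phi (a + b)) = 0 by rewrite -[a + b]phi3 z0 rmorph0.
apply: (@trivial_kernel F phi (tr b)) => //.
  rewrite !phi3; transitivity (tr a + tr b).
    by rewrite /tr !rmorphD /=; ring.
  by rewrite trab; apply: (eq_mod2 (k := tr b) h2); ring.
rewrite phi3 !rmorphD /=.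
move: fab; rewrite !fE trab => /addIr.
move: (phi (phi a)) (phi (phi b)) (tr b) => za zb t fab.
apply: (eq_mod2 (k := b ^+ 2 + (zb + t ^+ 2 * zb ^+ 2 + zb ^+ 4)
  + a * b + t ^+ 2 * za * zb + 2 * za ^+ 3 * zb + 3 * za ^+ 2 * zb ^+ 2
  + 2 * za * zb ^+ 3) h2).
transitivity ((a ^+ 2 + (za + t ^+ 2 * za ^+ 2 + za ^+ 4))
  + (b ^+ 2 + (zb + t ^+ 2 * zb ^+ 2 + zb ^+ 4))
  + 2 * (a * b + t ^+ 2 * za * zb + 2 * za ^+ 3 * zb + 3 * za ^+ 2 * zb ^+ 2
  + 2 * za * zb ^+ 3)); first by ring.
by rewrite fab; ring.
Qed.

Theorem theorem3p7 (m q : nat) (hm : (0 < m)%N) (hq : q = (2 ^ m)%N)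
    (F : finFieldType) (hF : #|F| = (q ^ 3)%N) :
  permutation_poly
    ('X^2 + 'X + 'X^q + 'X^(2 * q ^ 2 + 2 * q)%N + 'X^(2 * q ^ 2 + 2)%N
       : {poly F}).
Proof.
have pF : 2 \in [pchar F].
  by apply: (@card_finPcharP F 2 (m * 3)); rewrite // hF hq expnM.
have h2 : 2%:R = 0 :> F by exact: pcharf0.
pose phi0 (u : F) := u ^+ q.
have phiB : zmod_morphism phi0.
  have qn : [pchar F].-nat q by rewrite (eq_pnat _ (pcharf_eq pF)) hq pnatX.
  by move=> a b; rewrite /phi0 exprDn_pchar // exprNn_pchar.
have phiM : monoid_morphism phi0.
  by split=> [|a b]; rewrite /phi0 ?expr1n ?exprMn.
pose phiP := GRing.isZmodMorphism.Build F F phi0 phiB.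
pose phiQ := GRing.isMonoidMorphism.Build F F phi0 phiM.
pose phi : {rmorphism F -> F} := HB.pack phi0 phiP phiQ.
have phi3 u : phi (phi (phi u)) = u.
  by rewrite /= /phi0 -!exprM -[RHS]expf_card hF; congr (_ ^+ _).
apply: injF_bij => a b /=; rewrite !hornerD !hornerXn !hornerX => fab.
apply: (cubic_frobenius_injective h2 phi3) => /=.
(* The exponents 2q and 2q^2 are the squares of the first two conjugates, which matches the
   polynomial with the abstract map. *)
have sqr_phi u : phi0 u ^+ 2 = u ^+ (2 * q) by rewrite -exprM mulnC.
have sqr_phi2 u : phi0 (phi0 u) ^+ 2 = u ^+ (2 * q ^ 2).
  by rewrite /phi0 -!exprM mulnA mulnn mulnC.
by rewrite !sqr_phi2 !sqr_phi -!exprD.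
Qed.
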